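(* Let $a_1,a_2\in\mathbb C$ with $a_1\ne0$, $\alpha=1-a_1-2a_2$, $\beta=-2a_1^2$. The Takasaki system $$\frac{dq}{dt}=p,\qquad \frac{dp}{dt}=\frac{8\beta}{q^3}+(t^2-\alpha)q+\frac t2q^3+\frac3{64}q^5$$ on the bundle $\pi:E^{\mathrm{Tak}}\to\mathbb C_t$ (defined in the context) has a global Hamiltonian structure with respect to the 2-form on the fibre $E_t^{\mathrm{Tak}}$ extended from $dq\wedge dp$ in the original variables, in which all Hamiltonian functions are polynomial in the coordinates. That is, $E^{\mathrm{Tak}}$ admits a finite atlas of charts $\mathbb C^3_{x_i,y_i,t}$, compatible with the projection to $t$, such that in each chart the fibrewise 2-form is $\omega^{\mathrm{Tak}}=F_i(x_i,y_i)\,dx_i\wedge dy_i$ with $F_i$ independent of $t$, and the extended Takasaki system is $$F_i(x_i,y_i)\frac{dx_i}{dt}=\frac{\partial H_i}{\partial y_i},\qquad F_i(x_i,y_i)\frac{dy_i}{dt}=-\frac{\partial H_i}{\partial x_i}$$ for a function $H_i(x_i,y_i,t)$ that is polynomial in the coordinates.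
   Context: Blow-up convention: after blowing up a point given in an affine chart by $(x,y)=(x^*,y^* )$, the $i$-th exceptional curve is covered by charts $(u_i,v_i)$ and $(U_i,V_i)$ with $x-x^*=u_iv_i,\ y-y^*=v_i$ and $x-x^*=V_i,\ y-y^*=U_iV_i$. The notation $q_i\leftarrow q_j$ means that $q_j$ lies on the exceptional curve of $q_i$. Surface $\mathcal X^{\mathrm{Tak}}_t$: compactify $\mathbb C^2_{q,p}$ to $\mathbb P^1\times\mathbb P^1$ with $Q=1/q$, $P=1/p$, and blow up the 20 points $q_1:(q,P)=(0,0)$; over it $q_2:(u_1,v_1)=(4a_1,0)\leftarrow q_3:(u_2,v_2)=(0,0)$ and $q_4:(u_1,v_1)=(-4a_1,0)\leftarrow q_5:(u_4,v_4)=(0,0)$; $q_6:(Q,P)=(0,0)\leftarrow q_7:(U_6,V_6)=(0,0)\leftarrow q_8:(u_7,v_7)=(0,0)$; over $q_8$ the two chains $q_9:(u_8,v_8)=(8,0)\leftarrow q_{10}:(u_9,v_9)=(0,0)\leftarrow q_{11}:(u_{10},v_{10})=(-64t,0)\leftarrow q_{12}:(u_{11},v_{11})=(0,0)\leftarrow q_{13}:(u_{12},v_{12})=(256(2+2t^2-a_1-2a_2),0)\leftarrow q_{14}:(u_{13},v_{13})=(0,0)$ and $q_{15}:(u_8,v_8)=(-8,0)\leftarrow q_{16}:(u_{15},v_{15})=(0,0)\leftarrow q_{17}:(u_{16},v_{16})=(64t,0)\leftarrow q_{18}:(u_{17},v_{17})=(0,0)\leftarrow q_{19}:(u_{18},v_{18})=(-256(2t^2-a_1-2a_2),0)\leftarrow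 q_{20}:(u_{19},v_{19})=(0,0)$. $F_i$ denotes the (total transform of the) exceptional divisor of $q_i$. Inaccessible divisors: $D^{\mathrm{Tak}}$ is the union of the proper transforms of $\{q=0\}$, $\{q=\infty\}$, $\{p=\infty\}$ and of the proper transforms of the exceptional curves of all $q_i$ with $i\notin\{3,5,14,20\}$. The bundle is $E^{\mathrm{Tak}}\to\mathbb C_t$ with fibre $E_t^{\mathrm{Tak}}=\mathcal X_t^{\mathrm{Tak}}\setminus D^{\mathrm{Tak}}$. Here $\omega^{\mathrm{Tak}}$ is the holomorphic 2-form on each fibre extending $dq\wedge dp$, where $d$ is the exterior derivative along the fibre ($t$ is treated as a constant); it is allowed to have zeros. *)

(* Defs.v *)
From HB Require Import structures.
From mathcomp Require Import all_boot all_order all_algebra.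
From mathcomp Require Import all_classical all_reals all_analysis.
From mathcomp Require Export complex.

Set Implicit Arguments.
Unset Strict Implicit.
Unset Printing Implicit Defensive.

Import Order.TTheory GRing.Theory Num.Theory.
Import numFieldNormedType.Exports.

Local Open Scope classical_set_scope.
Local Open Scope ring_scope.

Inductive center :=
  | q1 | q2 | q3 | q4 | q5 | q6 | q7 | q8 | q9 | q10
  | q11 | q12 | q13 | q14 | q15 | q16 | q17 | q18 | q19 | q20.

(* The affine charts of the successive surfaces: the four charts of P^1 x P^1
   with coordinates (q,p), (q,P), (Q,p), (Q,P), where Q = 1/q and P = 1/p, and
   the charts (u_i,v_i), (U_i,V_i) covering the exceptional curve of q_i. *)
Inductive chart := qp | qP | Qp | QP | uv of center | UV of center.

Section Surface.
Variable C : numClosedFieldType.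
Variables a1 a2 : C.

Definition loc (t : C) (i : center) : chart * (C * C) :=
  match i with
  | q1 => (qP, (0, 0))
  | q2 => (uv q1, (4 * a1, 0))
  | q3 => (uv q2, (0, 0))
  | q4 => (uv q1, (- (4 * a1), 0))
  | q5 => (uv q4, (0, 0))
  | q6 => (QP, (0, 0))
  | q7 => (UV q6, (0, 0))
  | q8 => (uv q7, (0, 0))
  | q9 => (uv q8, (8, 0))
  | q10 => (uv q9, (0, 0))
  | q11 => (uv q10, (- (64 * t), 0))
  | q12 => (uv q11, (0, 0))
  | q13 => (uv q12, (256 * (2 + 2 * t ^+ 2 - a1 - 2 * a2), 0))
  | q14 => (uv q13, (0, 0))
  | q15 => (uv q8, (- 8, 0))
  | q16 => (uv q15, (0, 0))
  | q17 => (uv q16, (64 * t, 0))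
  | q18 => (uv q17, (0, 0))
  | q19 => (uv q18, (- (256 * (2 * t ^+ 2 - a1 - 2 * a2)), 0))
  | q20 => (uv q19, (0, 0))
  end.

(* Coordinates of the image under the blow-down of q_i, in the chart in which
   q_i = (x,y) is given. *)
Definition down_uv t i (u v : C) : chart * (C * C) :=
  let: (c, (x, y)) := loc t i in (c, (x + u * v, y + v)).

Definition down_UV t i (U V : C) : chart * (C * C) :=
  let: (c, (x, y)) := loc t i in (c, (x + V, y + U * V)).

(* Identification of coordinate points of different charts: the equivalence
   relation generated by the coordinate changes of P^1 x P^1, the blow-downs
   away from the exceptional curves, and u_i U_i = 1. *)
Inductive glue (t : C) : chart * (C * C) -> chart * (C * C) -> Prop :=
  | glue_refl a : glue t a a
  | glue_sym a b : glue t a b -> glue t b a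
  | glue_trans a b c : glue t a b -> glue t b c -> glue t a c
  | glue_qp_qP q p : p != 0 -> glue t (qp, (q, p)) (qP, (q, p^-1))
  | glue_qp_Qp q p : q != 0 -> glue t (qp, (q, p)) (Qp, (q^-1, p))
  | glue_qP_QP q P : q != 0 -> glue t (qP, (q, P)) (QP, (q^-1, P))
  | glue_Qp_QP Q p : p != 0 -> glue t (Qp, (Q, p)) (QP, (Q, p^-1))
  | glue_uv i u v : v != 0 -> glue t (uv i, (u, v)) (down_uv t i u v)
  | glue_UV i U V : V != 0 -> glue t (UV i, (U, V)) (down_UV t i U V)
  | glue_uv_UV i u v : u != 0 -> glue t (uv i, (u, v)) (UV i, (u^-1, u * v)).

(* Points are equivalence classes; the last component is t. *)
Definition tak_point := set (chart * (C * C) * C).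

Definition pt (c : chart) (z : C * C) (t : C) : tak_point :=
  [set w | w.2 = t /\ glue t (c, z) w.1].

(* A class containing some q_i is not a point of the blown-up surface: the
   point q_i has been replaced by its exceptional curve. *)
Definition takX (t : C) : set tak_point :=
  [set w | (exists c z, w = pt c z t) /\
           forall i, w <> pt (loc t i).1 (loc t i).2 t].

Definition takX_open (t : C) (O : set tak_point) : Prop :=
  O `<=` takX t /\ forall c, open [set z : C * C | O (pt c z t)].

Definition takX_closure (t : C) (S : set tak_point) : set tak_point :=
  [set w | takX t w /\ forall O, takX_open t O -> O w -> O `&` S !=set0].

Definition proper_transform (t : C) (S : set tak_point) : set tak_point :=
  takX_closure t (S `&` takX t).

Definition curve_q0 (t : C) : set tak_point :=
  [set w | exists y, w = pt qp (0, y) t \/ w = pt qP (0, y) t].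

Definition curve_qoo (t : C) : set tak_point :=
  [set w | exists y, w = pt Qp (0, y) t \/ w = pt QP (0, y) t].

Definition curve_poo (t : C) : set tak_point :=
  [set w | exists x, w = pt qP (x, 0) t \/ w = pt QP (x, 0) t].

Definition exceptional (t : C) (i : center) : set tak_point :=
  [set w | exists s, w = pt (uv i) (s, 0) t \/ w = pt (UV i) (s, 0) t].

Definition accessible (i : center) : bool :=
  match i with q3 | q5 | q14 | q20 => true | _ => false end.

Definition takD (t : C) : set tak_point :=
  [set w | [\/ proper_transform t (curve_q0 t) w,
               proper_transform t (curve_qoo t) w,
               proper_transform t (curve_poo t) w |
               exists2 i, ~~ accessible i &
                          proper_transform t (exceptional t i) w]].

(* The fibre over t of the bundle; the bundle itself is the disjoint union of
   the fibres, as t is recorded in each point. *)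
Definition takE (t : C) : set tak_point := takX t `\` takD t.

Definition holomorphic_near (V W : normedModType C) (f : V -> W) (v : V) :=
  \forall v' \near v, differentiable f v'.

(* phi is a biholomorphic map, over the t-line, from C^3 = {((x,y),t)} onto an
   open subset of the bundle, whose complex structure is given by the
   coordinates (z,t) of the points  pt c z t. *)
Definition bundle_chart (phi : C * C * C -> tak_point) : Prop :=
  [/\ injective phi,
      forall m, takE m.2 (phi m),
      forall m, exists c (g : C * C * C -> C * C),
        holomorphic_near g m /\
        \forall m' \near m, phi m' = pt c (g m') m'.2 &
      forall m c z, phi m = pt c z m.2 ->
        exists h : C * C * C -> C * C * C,
          holomorphic_near h (z, m.2) /\
          \forall w \near (z, m.2), phi (h w) = pt c w.1 w.2].

(* g = (q,p) is the expression near m of the original variables in the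
   chart phi. *)
Definition original_vars (phi : C * C * C -> tak_point)
    (g : C * C * C -> C * C) (m : C * C * C) : Prop :=
  holomorphic_near g m /\ \forall m' \near m, phi m' = pt qp (g m') m'.2.

Definition ex : C * C * C := ((1, 0), 0).
Definition ey : C * C * C := ((0, 1), 0).

(* In the chart phi, F(x,y) dx /\ dy is the holomorphic extension of
   dq /\ dp = (q_x p_y - q_y p_x) dx /\ dy. *)
Definition extends_dq_dp (phi : C * C * C -> tak_point) (F : C * C -> C) : Prop :=
  (forall z, differentiable F z) /\
  forall m g, original_vars phi g m ->
    F m.1 = ('D_ex g m).1 * ('D_ey g m).2 - ('D_ey g m).1 * ('D_ex g m).2.

Definition takasaki (alpha beta t : C) (z : C * C) : C * C :=
  let: (q, p) := z in
  (p, 8 * beta / q ^+ 3 + (t ^+ 2 - alpha) * q + t / 2 * q ^+ 3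
      + 3 / 64 * q ^+ 5).

(* (dx/dt, dy/dt) = (x', y') is the Takasaki system rewritten in the chart phi
   iff the chain rule sends the direction (x', y', 1) to (dq/dt, dp/dt). The
   rewritten system may have poles on the zero set of F, so it is pinned on the
   dense open set of the original variables and extends from there since F and
   H are holomorphic. *)
Definition hamiltonian_in_chart (alpha beta : C)
    (phi : C * C * C -> tak_point) (F : C * C -> C) (H : C * C * C -> C) : Prop :=
  forall m g, original_vars phi g m ->
  forall x' y' : C,
    'D_((x', y'), 1) g m = takasaki alpha beta m.2 (g m) <->
    F m.1 * x' = 'D_ey H m /\ F m.1 * y' = - 'D_ex H m.

Definition eval3 (h : {poly {poly {poly C}}}) (m : C * C * C) : C :=
  h.[m.2%:P%:P].[m.1.2%:P].[m.1.1].

End Surface.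

(* Main.v *)
Require Import Defs.
From HB Require Import structures.
From mathcomp Require Import all_boot all_order all_algebra.
From mathcomp Require Import all_classical all_reals all_analysis.
From mathcomp Require Import complex ring.
Import Order.TTheory GRing.Theory Num.Theory.
Import numFieldNormedType.Exports.
Import Defs.
Local Open Scope classical_set_scope.
Local Open Scope ring_scope.
Local Open Scope complex_scope.

Set Implicit Arguments.
Unset Strict Implicit.
Unset Printing Implicit Defensive.

(* Near the four accessible exceptional curves the solutions of the system have
   the expansions  q p = b + y q^2  with b = 4 a_1 or - 4 a_1 as q tends to 0, and
   p = s (q^3 / 8 + t q) + c / q + y / q^3  with s = 1 or - 1 as q tends to
   infinity, where c does not depend on t. Taking x = q, respectively x = 1 / q,
   and the coefficient y as coordinates gives four charts C^2; each of them covers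
   {q <> 0} and one accessible curve, at x = 0, while {q = 0} and the other
   curves lie in D. In these charts dq /\ dp is x dx /\ dy, respectively
   - x dx /\ dy, and the Hamiltonian is polynomial by direct computation.

   Whether two coordinate points represent the same point of the surface is
   decided by a normal form: blow down as long as the point is not on the last
   exceptional curve, then leave the charts at infinity if possible. *)

(** * Normal forms of the points *)

Definition center_depth (i : center) : nat :=
  match i with
  | q1 | q6 => 0
  | q2 | q4 | q7 => 1
  | q3 | q5 | q8 => 2
  | q9 | q15 => 3
  | q10 | q16 => 4
  | q11 | q17 => 5
  | q12 | q18 => 6
  | q13 | q19 => 7
  | q14 | q20 => 8
  end.

Definition chart_depth (c : chart) : nat :=
  match c with uv i | UV i => (center_depth i).+1 | _ => 0 end.

Lemma chart_depth_loc (C : numClosedFieldType) (a1 a2 t : C) i :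
  chart_depth (loc a1 a2 t i).1 = center_depth i.
Proof. by case: i. Qed.

Lemma down_uvE (C : numClosedFieldType) (a1 a2 t : C) i u v :
  down_uv a1 a2 t i u v = ((loc a1 a2 t i).1,
    ((loc a1 a2 t i).2.1 + u * v, (loc a1 a2 t i).2.2 + v)).
Proof. by rewrite /down_uv; case: (loc a1 a2 t i) => c []. Qed.

Lemma down_UVE (C : numClosedFieldType) (a1 a2 t : C) i U V :
  down_UV a1 a2 t i U V = ((loc a1 a2 t i).1,
    ((loc a1 a2 t i).2.1 + V, (loc a1 a2 t i).2.2 + U * V)).
Proof. by rewrite /down_UV; case: (loc a1 a2 t i) => c []. Qed.

(* The fuel [n] bounds the number of blow-downs; it suffices as soon as it is
   at least the depth of the chart. *)
Fixpoint normal_rec (C : numClosedFieldType) (a1 a2 t : C) (n : nat)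
    (w : chart * (C * C)) : chart * (C * C) :=
  let: (c, (x, y)) := w in
  match c with
  | qp => w
  | qP => if y == 0 then w else (qp, (x, y^-1))
  | Qp => if x == 0 then w else (qp, (x^-1, y))
  | QP => if x == 0 then if y == 0 then w else (Qp, (0, y^-1))
          else if y == 0 then (qP, (x^-1, 0)) else (qp, (x^-1, y^-1))
  | uv i => if y == 0 then w
            else if n is n'.+1 then
              normal_rec a1 a2 t n' (down_uv a1 a2 t i x y)
            else w
  | UV i => if y == 0 then if x == 0 then w else (uv i, (x^-1, 0))
            else if n is n'.+1 then
              normal_rec a1 a2 t n' (down_UV a1 a2 t i x y)
            else w
  end.

Definition normal_form (C : numClosedFieldType) (a1 a2 t : C) w :=
  normal_rec a1 a2 t (chart_depth w.1) w.

Lemma normal_uv (C : numClosedFieldType) (a1 a2 t : C) i u v : v != 0 ->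
  normal_form a1 a2 t (uv i, (u, v)) = normal_form a1 a2 t (down_uv a1 a2 t i u v).
Proof.
move=> v0; rewrite {1}/normal_form /= (negPf v0).
by rewrite /normal_form down_uvE chart_depth_loc.
Qed.

Lemma normal_uv0 (C : numClosedFieldType) (a1 a2 t : C) i u :
  normal_form a1 a2 t (uv i, (u, 0)) = (uv i, (u, 0)).
Proof. by rewrite /normal_form /= eqxx. Qed.

Lemma normal_UV (C : numClosedFieldType) (a1 a2 t : C) i U V : V != 0 ->
  normal_form a1 a2 t (UV i, (U, V)) = normal_form a1 a2 t (down_UV a1 a2 t i U V).
Proof.
move=> v0; rewrite {1}/normal_form /= (negPf v0).
by rewrite /normal_form down_UVE chart_depth_loc.
Qed.

Lemma normal_UV0 (C : numClosedFieldType) (a1 a2 t : C) i U :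
  normal_form a1 a2 t (UV i, (U, 0)) =
  if U == 0 then (UV i, (U, 0)) else (uv i, (U^-1, 0)).
Proof. by rewrite /normal_form /= eqxx. Qed.

(** The centre of a blow-up lies in a chart of depth one less than the charts of its exceptional
    curve, so blowing down terminates. Points on an exceptional curve are base cases because the
    blow-down is glued only away from it. *)
Lemma blow_down_ind (C : numClosedFieldType) (a1 a2 t : C)
    (Q : chart * (C * C) -> Prop) :
  (forall c x y, chart_depth c = 0 -> Q (c, (x, y))) ->
  (forall i u, Q (uv i, (u, 0))) ->
  (forall i U, Q (UV i, (U, 0))) ->
  (forall i (u v : C), v != 0 -> Q (down_uv a1 a2 t i u v) -> Q (uv i, (u, v))) ->
  (forall i (U V : C), V != 0 -> Q (down_UV a1 a2 t i U V) -> Q (UV i, (U, V))) ->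
  forall w, Q w.
Proof.
move=> Q0 Quv0 QUV0 Quv QUV w.
have [n] := ubnP (chart_depth w.1).
elim: n w => // n IHn [c [x y]] /=.
case: c => [||||i|i] /=; rewrite ltnS => le_n; try exact: Q0.
- have [->|y0] := eqVneq y 0; first exact: Quv0.
  by apply: Quv => //; apply: IHn; rewrite down_uvE chart_depth_loc.
- have [->|y0] := eqVneq y 0; first exact: QUV0.
  by apply: QUV => //; apply: IHn; rewrite down_UVE chart_depth_loc.
Qed.

(** Each reduction step of the normal form is itself a gluing, or the inverse of one. *)
Lemma glue_normal (C : numClosedFieldType) (a1 a2 t : C) w :
  glue a1 a2 t w (normal_form a1 a2 t w).
Proof.
elim/(@blow_down_ind C a1 a2 t): w => [c x y|i u|i U|i u v v0 IH|i U V V0 IH].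
- case: c => // _; rewrite /normal_form /=.
  + exact: glue_refl.
  + have [->|y0] := eqVneq y 0; first exact: glue_refl.
    by apply: glue_sym; rewrite -{2}[y]invrK; apply: glue_qp_qP; rewrite invr_eq0.
  + have [->|x0] := eqVneq x 0; first exact: glue_refl.
    by apply: glue_sym; rewrite -{2}[x]invrK; apply: glue_qp_Qp; rewrite invr_eq0.
  + have [->|x0] := eqVneq x 0; have [->|y0] := eqVneq y 0.
    * exact: glue_refl.
    * by apply: glue_sym; rewrite -{2}[y]invrK; apply: glue_Qp_QP; rewrite invr_eq0.
    * by apply: glue_sym; rewrite -{2}[x]invrK; apply: glue_qP_QP; rewrite invr_eq0.
    * apply: (@glue_trans _ _ _ _ _ (Qp, (x, y^-1))).
        by apply: glue_sym; rewrite -{2}[y]invrK; apply: glue_Qp_QP; rewrite invr_eq0.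
      by apply: glue_sym; rewrite -{2}[x]invrK; apply: glue_qp_Qp; rewrite invr_eq0.
- by rewrite normal_uv0; exact: glue_refl.
- rewrite normal_UV0; have [->|U0] := eqVneq U 0; first exact: glue_refl.
  have := @glue_uv_UV C a1 a2 t i U^-1 0; rewrite invr_eq0 invrK mulr0.
  by move=> /(_ U0); exact: glue_sym.
- by rewrite normal_uv //; apply: glue_trans IH; exact: glue_uv.
- by rewrite normal_UV //; apply: glue_trans IH; exact: glue_UV.
Qed.

(** It suffices to check the generators of the gluing. For [glue_uv_UV] off the exceptional curve,
    both charts blow down to the same point. With [glue_normal] this makes the normal form a
    complete invariant of points. *)
Lemma normal_glue (C : numClosedFieldType) (a1 a2 t : C) w w' :
  glue a1 a2 t w w' -> normal_form a1 a2 t w = normal_form a1 a2 t w'.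
Proof.
elim=> //= {w w'}.
- by move=> a b c _ -> _ ->.
- by move=> q p p0; rewrite /normal_form /= invr_eq0 (negPf p0) invrK.
- by move=> q p q0; rewrite /normal_form /= invr_eq0 (negPf q0) invrK.
- by move=> q P q0; rewrite /normal_form /= invr_eq0 (negPf q0) invrK; case: eqP => // ->.
- by move=> Q p p0; rewrite /normal_form /= invr_eq0 (negPf p0) invrK; case: eqP => // ->.
- by move=> i u v v0; rewrite normal_uv.
- by move=> i U V V0; rewrite normal_UV.
- move=> i u v u0; have [->|v0] := eqVneq v 0.
    by rewrite mulr0 normal_uv0 normal_UV0 invr_eq0 (negPf u0) invrK.
  rewrite normal_uv // normal_UV ?mulf_neq0 //.
  by rewrite down_uvE down_UVE mulrA mulVf // mul1r.
Qed.

Lemma pt_eqP (C : numClosedFieldType) (a1 a2 : C) c z t c' z' t' :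
  pt a1 a2 c z t = pt a1 a2 c' z' t' <->
  t = t' /\ normal_form a1 a2 t (c, z) = normal_form a1 a2 t (c', z').
Proof.
split=> [e|[<- e]].
  have : pt a1 a2 c z t ((c, z), t) by split=> //; exact: glue_refl.
  by rewrite e => -[/= <-] /normal_glue ->.
have g : glue a1 a2 t (c, z) (c', z').
  apply: glue_trans (glue_normal _ _ _ _) _.
  by rewrite e; exact: glue_sym (glue_normal _ _ _ _).
apply/seteqP; split=> w [wt gw]; split=> //.
  exact: glue_trans (glue_sym g) gw.
exact: glue_trans g gw.
Qed.

Lemma pt_normal (C : numClosedFieldType) (a1 a2 : C) c z t :
  pt a1 a2 c z t =
  pt a1 a2 (normal_form a1 a2 t (c, z)).1 (normal_form a1 a2 t (c, z)).2 t.
Proof.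
apply/pt_eqP; split=> //; rewrite -surjective_pairing.
exact/normal_glue/glue_normal.
Qed.

Lemma glue_pt (C : numClosedFieldType) (a1 a2 : C) c z t c' z' :
  glue a1 a2 t (c, z) (c', z') -> pt a1 a2 c z t = pt a1 a2 c' z' t.
Proof. by move=> /normal_glue e; apply/pt_eqP. Qed.

(* The normal forms of the points of the fibre of E. *)
Definition in_fibre (C : numClosedFieldType) (w : chart * (C * C)) : bool :=
  match w.1 with
  | qp => w.2.1 != 0
  | uv i => accessible i && (w.2.2 == 0)
  | _ => false
  end.

(** The zeros mark where reduction stops: with a nonzero coordinate there, the point would pass to
    another chart. On an exceptional curve only the point at infinity of the chart [uv i] remains in
    [UV i]. *)
Inductive normal_spec (C : numClosedFieldType) :
    chart * (C * C) -> Prop :=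
  | Normal_qp q p : normal_spec (qp, (q, p))
  | Normal_qP q : normal_spec (qP, (q, 0))
  | Normal_Qp p : normal_spec (Qp, (0, p))
  | Normal_QP : normal_spec (QP, (0, 0))
  | Normal_uv i u : normal_spec (uv i, (u, 0))
  | Normal_UV i : normal_spec (UV i, (0, 0)).

Lemma normal_formP (C : numClosedFieldType) (a1 a2 t : C) w :
  normal_spec (normal_form a1 a2 t w).
Proof.
elim/(@blow_down_ind C a1 a2 t): w => [c x y|i u|i U|i u v v0 IH|i U V V0 IH].
- case: c => // _; rewrite /normal_form /=; first by constructor.
  + by have [->|?] := eqVneq y 0; constructor.
  + by have [->|?] := eqVneq x 0; constructor.
  + case: eqVneq => [->|_]; last by case: eqVneq => _; constructor.
    by case: eqVneq => [->|_]; constructor.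
- by rewrite normal_uv0; constructor.
- by rewrite normal_UV0; have [->|?] := eqVneq U 0; constructor.
- by rewrite normal_uv.
- by rewrite normal_UV.
Qed.

(** Every centre is its own normal form, and none lies in the chart [qp] or on an accessible curve.
    Hence points with normal form in the fibre are not among those removed by blowing up. *)
Lemma loc_notin_fibre (C : numClosedFieldType) (a1 a2 t : C) i :
  in_fibre (normal_form a1 a2 t (loc a1 a2 t i)) = false.
Proof. by case: i; rewrite /= /normal_form /= eqxx. Qed.

(** * Rules of differentiation *)

(* A wrapper around the class [is_diff], so that instances are only built by
   the explicit rules below. *)
Definition has_diff (K : numFieldType) (V W : normedModType K)
    (f : V -> W) (x : V) (df : V -> W) : Prop := is_diff x f df.

Lemma has_diff_cst (K : numFieldType) (V W : normedModType K) (a : W) (x : V) :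
  has_diff (fun=> a) x (fun=> 0).
Proof. exact: is_diff_cst. Qed.

Lemma has_diff_id (K : numFieldType) (V : normedModType K) (x : V) :
  has_diff (fun m => m) x (fun v => v).
Proof. exact: is_diff_id. Qed.

Lemma has_diff_fst (K : numFieldType) (U V W : normedModType K)
    (f : U -> V * W) x df :
  has_diff f x df -> has_diff (fun m => (f m).1) x (fun v => (df v).1).
Proof.
move=> fd; apply: (@is_diff_comp _ _ _ _ f df fst fst) => //.
have c : continuous (fst : V * W -> V) by move=> y; exact: cvg_fst.
by apply: DiffDef; [exact: (@linear_differentiable _ _ _ fst)|exact: (@diff_lin _ _ _ fst)].
Qed.

Lemma has_diff_snd (K : numFieldType) (U V W : normedModType K)
    (f : U -> V * W) x df :
  has_diff f x df -> has_diff (fun m => (f m).2) x (fun v => (df v).2).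
Proof.
move=> fd; apply: (@is_diff_comp _ _ _ _ f df snd snd) => //.
have c : continuous (snd : V * W -> W) by move=> y; exact: cvg_snd.
by apply: DiffDef; [exact: (@linear_differentiable _ _ _ snd)|exact: (@diff_lin _ _ _ snd)].
Qed.

Lemma has_diff_pair (K : numFieldType) (U V W : normedModType K)
    (f df : U -> V) (g dg : U -> W) x :
  has_diff f x df -> has_diff g x dg ->
  has_diff (fun m => (f m, g m)) x (fun v => (df v, dg v)).
Proof. exact: is_diff_pair. Qed.

Section ScalarRules.
Variables (K : numFieldType) (V : normedModType K).
Implicit Types (f g df dg : V -> K) (x : V).

Lemma has_diffD f g x df dg : has_diff f x df -> has_diff g x dg ->
  has_diff (fun m => f m + g m) x (fun v => df v + dg v).
Proof. exact: is_diffD. Qed.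

Lemma has_diffN f x df : has_diff f x df ->
  has_diff (fun m => - f m) x (fun v => - df v).
Proof. exact: is_diffN. Qed.

Lemma has_diffM f g x df dg : has_diff f x df -> has_diff g x dg ->
  has_diff (fun m => f m * g m) x (fun v => f x * dg v + g x * df v).
Proof. exact: is_diffM. Qed.

Lemma has_diffX f x df n : has_diff f x df ->
  has_diff (fun m => f m ^+ n.+1) x (fun v => n.+1%:R * f x ^+ n * df v).
Proof.
move=> fd; have -> : (fun m => f m ^+ n.+1) = f ^+ n.+1.
  by rewrite exprfctE.
exact: is_diffX.
Qed.

Lemma has_diffV f x df : f x != 0 -> has_diff f x df ->
  has_diff (fun m => (f m)^-1) x (fun v => - (f x) ^- 2 * df v).
Proof.
move=> fx0 [fd <-]; apply: DiffDef; first exact: differentiableV.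
by rewrite diffV.
Qed.

End ScalarRules.

Lemma has_diff_differentiable (K : numFieldType) (V W : normedModType K)
    (f : V -> W) x df : has_diff f x df -> differentiable f x.
Proof. by case. Qed.

Lemma has_diff_derive (K : numFieldType) (V W : normedModType K)
    (f : V -> W) x df v : has_diff f x df -> 'D_v f x = df v.
Proof. by move=> [fd <-]; rewrite deriveE. Qed.

Ltac diff_rule :=
  first [ simple eapply has_diff_cst | simple eapply has_diff_id
        | simple eapply has_diff_pair
        | simple eapply has_diffD | simple eapply has_diffN
        | simple eapply has_diffM | simple eapply has_diffX
        | simple eapply has_diffV
        | simple eapply has_diff_fst | simple eapply has_diff_snd ].
Ltac differentiate := eapply has_diff_differentiable; repeat diff_rule.

(** * Holomorphy near a point and local changes of chart *)

Lemma nbhs_all (C : numFieldType) (V : normedModType C) (x : V) (P : set V) :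
  (forall y, P y) -> nbhs x P.
Proof. exact: nearW. Qed.

Lemma differentiable_near_neq0 (C : numFieldType) (V : normedModType C)
    (f : V -> C) v :
  differentiable f v -> f v != 0 -> \forall v' \near v, f v' != 0.
Proof.
move=> /differentiable_continuous fc fv0.
exact: cvgr_neq0 fc fv0.
Qed.

Lemma holomorphic_near_neq0 (C : numClosedFieldType) (V W : normedModType C)
    (f : V -> C) (g : V -> W) v :
  (forall v', differentiable f v') ->
  (forall v', f v' != 0 -> differentiable g v') -> f v != 0 ->
  holomorphic_near g v.
Proof.
move=> fd gd fv0; apply: filterS gd _.
exact: differentiable_near_neq0.
Qed.

Lemma holomorphic_near_comp (C : numClosedFieldType) (U V W : normedModType C)
    (f : U -> V) (g : V -> W) x :
  holomorphic_near f x -> holomorphic_near g (f x) ->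
  holomorphic_near (g \o f) x.
Proof.
move=> fh gh.
have gf : \forall x' \near x, differentiable g (f x').
  exact: (differentiable_continuous (nbhs_singleton fh)) gh.
apply: filterS2 fh gf => x'; exact: differentiable_comp.
Qed.

Lemma holomorphic_near_pair (C : numClosedFieldType) (U V W : normedModType C)
    (f : U -> V) (g : U -> W) x :
  holomorphic_near f x -> holomorphic_near g x ->
  holomorphic_near (fun y => (f y, g y)) x.
Proof. by move=> fh gh; apply: filterS2 fh gh => y; exact: differentiable_pair. Qed.

Lemma differentiable_snd (C : numFieldType) (V W : normedModType C) (x : V * W) :
  differentiable (snd : V * W -> W) x.
Proof. by differentiate. Qed.

Lemma holomorphic_near_snd (C : numClosedFieldType) (V W : normedModType C) (x : V * W) :
  holomorphic_near (snd : V * W -> W) x.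
Proof. by apply: nbhs_all => y; exact: differentiable_snd. Qed.

Lemma loc_chart (C : numClosedFieldType) (a1 a2 t t' : C) i :
  (loc a1 a2 t i).1 = (loc a1 a2 t' i).1.
Proof. by case: i. Qed.

Lemma differentiable_down_uv (C : numClosedFieldType) (a1 a2 : C) i
    (m : C * C * C) :
  differentiable (fun m : C * C * C =>
    ((down_uv a1 a2 m.2 i m.1.1 m.1.2).2, m.2)) m.
Proof. by case: i; rewrite /down_uv /=; differentiate. Qed.

Lemma differentiable_down_UV (C : numClosedFieldType) (a1 a2 : C) i
    (m : C * C * C) :
  differentiable (fun m : C * C * C =>
    ((down_UV a1 a2 m.2 i m.1.1 m.1.2).2, m.2)) m.
Proof. by case: i; rewrite /down_UV /=; differentiate. Qed.

(** The reduction steps taken at [w] require only that some coordinates be nonzero, an open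
    condition, so the same steps apply nearby and compose to a holomorphic map [k]. Near an
    exceptional curve [k m] need not be a normal form; it only stays in the chart of the normal form
    at [w]. *)
Lemma normal_local (C : numClosedFieldType) (a1 a2 t : C) (w : chart * (C * C)) :
  match (normal_form a1 a2 t w).1 with qp | uv _ => true | _ => false end ->
  exists k : C * C * C -> C * C,
    [/\ holomorphic_near k (w.2, t), k (w.2, t) = (normal_form a1 a2 t w).2 &
        \forall m \near (w.2, t), pt a1 a2 w.1 m.1 m.2 =
          pt a1 a2 (normal_form a1 a2 t w).1 (k m) m.2].
Proof.
have near1 (m : C * C * C) : m.1.1 != 0 -> \forall m' \near m, m'.1.1 != 0.
  apply: (@differentiable_near_neq0 _ _ (fun m : C * C * C => m.1.1)).
  by differentiate.
have near2 (m : C * C * C) : m.1.2 != 0 -> \forall m' \near m, m'.1.2 != 0.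
  apply: (@differentiable_near_neq0 _ _ (fun m : C * C * C => m.1.2)).
  by differentiate.
elim/(@blow_down_ind C a1 a2 t): w => [c x y|i u|i U|i u v v0 IH|i U V V0 IH].
- case: c => // _; rewrite /normal_form /=.
  + move=> _; exists fst; split=> //; last by apply: nbhs_all.
    by apply: nbhs_all => m; differentiate.
  + case: ifPn => //= y0 _; exists (fun m => (m.1.1, m.1.2^-1)); split=> //.
      apply: (@holomorphic_near_neq0 _ _ _ (fun m : C * C * C => m.1.2)) => //.
        by move=> ?; differentiate.
      by move=> /= ? ?; differentiate.
    apply: filterS (near2 ((x, y), t) y0) => -[[x' y'] t'] /= y'0.
    by apply/pt_eqP; split=> //; rewrite /normal_form /= (negPf y'0).
  + case: ifPn => //= x0 _; exists (fun m => (m.1.1^-1, m.1.2)); split=> //.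
      apply: (@holomorphic_near_neq0 _ _ _ (fun m : C * C * C => m.1.1)) => //.
        by move=> ?; differentiate.
      by move=> /= ? ?; differentiate.
    apply: filterS (near1 ((x, y), t) x0) => -[[x' y'] t'] /= x'0.
    by apply/pt_eqP; split=> //; rewrite /normal_form /= (negPf x'0).
  + case: ifPn => //= x0; case: ifPn => //= y0 _ => //.
    exists (fun m => (m.1.1^-1, m.1.2^-1)); split=> //.
      apply: (@holomorphic_near_neq0 _ _ _ (fun m : C * C * C => m.1.1 * m.1.2)) => //.
      * by move=> ?; differentiate.
      * by move=> /= ?; rewrite mulf_eq0 negb_or => /andP[? ?]; differentiate.
      * by rewrite mulf_neq0.
    apply: filterS2 (near1 ((x, y), t) x0) (near2 ((x, y), t) y0).
    move=> -[[x' y'] t'] /= x'0 y'0.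
    by apply/pt_eqP; split=> //; rewrite /normal_form /= (negPf x'0) (negPf y'0).
- move=> _; rewrite normal_uv0; exists fst; split=> //; last by apply: nbhs_all.
  by apply: nbhs_all => m; differentiate.
- rewrite normal_UV0; have [->//|U0 _] := eqVneq U 0.
  (* The change from [UV i] to [uv i] is valid for [U <> 0], also across the exceptional curve. *)
  exists (fun m => (m.1.1^-1, m.1.1 * m.1.2)); split=> //=.
  + apply: (@holomorphic_near_neq0 _ _ _ (fun m : C * C * C => m.1.1)) => //.
      by move=> ?; differentiate.
    by move=> /= ? ?; differentiate.
  + by rewrite mulr0.
  + apply: filterS (near1 ((U, 0), t) U0) => -[[x' y'] t'] /= x'0.
    apply/esym/glue_pt; have := @glue_uv_UV C a1 a2 t' i x'^-1 (x' * y').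
    by rewrite invr_eq0 invrK mulKf //; exact.
- rewrite normal_uv // => /IH [k [kh k1 k2]].
  (* The time is carried along because the centres move with it. *)
  pose f (m : C * C * C) := ((down_uv a1 a2 m.2 i m.1.1 m.1.2).2, m.2).
  have fh : holomorphic_near f ((u, v), t).
    exact: nbhs_all (differentiable_down_uv _ _ _).
  exists (k \o f); split=> //; first exact: holomorphic_near_comp.
  have := differentiable_continuous (nbhs_singleton fh) k2.
  apply: filterS2 (near2 ((u, v), t) v0) => -[[u' v'] t'] /= v'0 <-.
  apply: glue_pt; have := glue_uv a1 a2 t' i u' v'0.
  by rewrite !down_uvE (loc_chart a1 a2 t t').
- rewrite normal_UV // => /IH [k [kh k1 k2]].
  pose f (m : C * C * C) := ((down_UV a1 a2 m.2 i m.1.1 m.1.2).2, m.2).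
  have fh : holomorphic_near f ((U, V), t).
    exact: nbhs_all (differentiable_down_UV _ _ _).
  exists (k \o f); split=> //; first exact: holomorphic_near_comp.
  have := differentiable_continuous (nbhs_singleton fh) k2.
  apply: filterS2 (near2 ((U, V), t) V0) => -[[u' v'] t'] /= v'0 <-.
  apply: glue_pt; have := glue_UV a1 a2 t' i u' v'0.
  by rewrite !down_UVE (loc_chart a1 a2 t t').
Qed.

(** * Charts around an accessible curve *)

(* A chart [(x,y,t)] whose line [x = 0] covers the accessible exceptional curve
   of [exc_center]: [orig] and [inv_orig] are the change to the variables [(q,p)]
   and its inverse for [x <> 0] and [q <> 0]; [exc] and [unexc] are the change
   to the coordinates [(u,v)] of that curve and its inverse, where [exc_dom] and
   [unexc_dom] do not vanish. *)
Record chart_data (C : numClosedFieldType) (a1 a2 : C) := ChartData {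
  exc_center : center;
  exc_parent : center;
  orig : C * C * C -> C * C;
  inv_orig : C * C * C -> C * C;
  exc : C * C * C -> C * C;
  unexc : C * C * C -> C * C;
  exc_dom : C * C * C -> C;
  unexc_dom : C * C * C -> C;
  exc_centerP : accessible exc_center;
  exc_parentP : ~~ accessible exc_parent;
  loc_exc_center : forall t, loc a1 a2 t exc_center = (uv exc_parent, (0, 0));
  differentiable_orig : forall m, m.1.1 != 0 -> differentiable orig m;
  differentiable_inv_orig : forall m, m.1.1 != 0 -> differentiable inv_orig m;
  differentiable_exc : forall m, exc_dom m != 0 -> differentiable exc m;
  differentiable_unexc : forall m, unexc_dom m != 0 -> differentiable unexc m;
  differentiable_exc_dom : forall m, differentiable exc_dom m;
  differentiable_unexc_dom : forall m, differentiable unexc_dom m;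
  orig_neq0 : forall m, m.1.1 != 0 -> (orig m).1 != 0;
  inv_orig_neq0 : forall m, m.1.1 != 0 -> (inv_orig m).1 != 0;
  inv_origK : forall m, m.1.1 != 0 -> orig (inv_orig m, m.2) = m.1;
  origK : forall m, m.1.1 != 0 -> inv_orig (orig m, m.2) = m.1;
  exc_dom0 : forall y t, exc_dom (0, y, t) != 0;
  unexc_dom0 : forall u t, unexc_dom (u, 0, t) != 0;
  exc0 : forall y t, (exc (0, y, t)).2 = 0;
  unexc0 : forall u t, (unexc (u, 0, t)).1 = 0;
  unexc_dom_exc : forall m, exc_dom m != 0 -> unexc_dom (exc m, m.2) != 0;
  excK : forall m, exc_dom m != 0 -> unexc (exc m, m.2) = m.1;
  unexc0K : forall u t, exc (unexc (u, 0, t), t) = (u, 0);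
  unexc_neq0 : forall w, w.1.2 != 0 -> unexc_dom w != 0 -> (unexc w).1 != 0;
  unexc_glue : forall w, w.1.2 != 0 -> unexc_dom w != 0 ->
    glue a1 a2 w.2 (uv exc_center, w.1) (qp, orig (unexc w, w.2))
}.

Section AccessibleChart.
Variables (C : numClosedFieldType) (a1 a2 : C) (D : chart_data a1 a2).

Definition accessible_chart (m : C * C * C) : tak_point C :=
  if m.1.1 != 0 then pt a1 a2 qp (orig D m) m.2
  else pt a1 a2 (uv (exc_center D)) (exc D m) m.2.

Lemma near_x_neq0 (m : C * C * C) : m.1.1 != 0 -> \forall m' \near m, m'.1.1 != 0.
Proof.
apply: (@differentiable_near_neq0 _ _ (fun m : C * C * C => m.1.1)).
by differentiate.
Qed.

(** The zero on the line [x = 0] is written out, which makes the value visibly a normal form; [excE]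
    justifies it. *)
Definition chart_normal (m : C * C * C) : chart * (C * C) :=
  if m.1.1 != 0 then (qp, orig D m) else (uv (exc_center D), ((exc D m).1, 0)).

Lemma excE m : m.1.1 = 0 -> exc D m = ((exc D m).1, 0).
Proof.
by case: m => -[x y] t /= ->; rewrite [LHS]surjective_pairing exc0.
Qed.

Lemma accessible_chartE m :
  accessible_chart m = pt a1 a2 (chart_normal m).1 (chart_normal m).2 m.2.
Proof.
rewrite /accessible_chart /chart_normal.
by case: ifPn => //= /negPn/eqP m0; rewrite excE.
Qed.

Lemma normal_chart_normal m t :
  normal_form a1 a2 t (chart_normal m) = chart_normal m.
Proof.
rewrite /chart_normal; case: ifPn => _; last by rewrite normal_uv0.
by rewrite /normal_form /=; case: (orig D m).
Qed.

Lemma accessible_chart_eq m c z t : accessible_chart m = pt a1 a2 c z t <->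
  m.2 = t /\ chart_normal m = normal_form a1 a2 t (c, z).
Proof.
rewrite accessible_chartE pt_eqP -surjective_pairing.
by split=> -[e]; rewrite e normal_chart_normal.
Qed.

Lemma in_fibre_chart_normal m : in_fibre (chart_normal m).
Proof.
rewrite /chart_normal /in_fibre; case: ifPn => /= [m0|_]; first exact: orig_neq0.
by rewrite exc_centerP eqxx.
Qed.

Lemma accessible_chart_inj : injective accessible_chart.
Proof.
move=> m m'; rewrite [RHS]accessible_chartE accessible_chart_eq.
rewrite -surjective_pairing normal_chart_normal => -[e].
(* The mixed cases are impossible, since the two kinds of normal form lie in different charts. *)
rewrite /chart_normal; case: ifPn => m0; case: ifPn => m'0 //.
  move=> [] eo; have := origK D m0; rewrite eo e origK // => e1.
  by rewrite [m]surjective_pairing [m']surjective_pairing e e1.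
move/negPn/eqP: m0 => m0; move/negPn/eqP: m'0 => m'0.
move=> [] ee; have : exc D m = exc D m' by rewrite excE // [RHS]excE // ee.
have d (n : C * C * C) : n.1.1 = 0 -> exc_dom D n != 0.
  by case: n => -[x y] t /= ->; exact: exc_dom0.
move=> eo; have := excK (d _ m0); rewrite eo e excK; last exact: d.
by move=> e1; rewrite [m]surjective_pairing [m']surjective_pairing e e1.
Qed.

Lemma unexcK (w : C * C * C) : unexc_dom D w != 0 ->
  accessible_chart (unexc D w, w.2) = pt a1 a2 (uv (exc_center D)) w.1 w.2.
Proof.
have [w0|w0] := eqVneq w.1.2 0.
  case: w w0 => -[u v] t /= -> _.
  by rewrite /accessible_chart /= unexc0 eqxx /= unexc0K.
move=> dw; rewrite /accessible_chart /= unexc_neq0 //.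
exact/esym/glue_pt/unexc_glue.
Qed.

(** The coordinates of the exceptional curve describe the chart on a whole neighbourhood of [x = 0],
    so the two branches of its definition fit together holomorphically. *)
Lemma accessible_chart_exc (m : C * C * C) : exc_dom D m != 0 ->
  accessible_chart m = pt a1 a2 (uv (exc_center D)) (exc D m) m.2.
Proof.
move=> dm; rewrite -(unexcK (unexc_dom_exc dm)) /= excK //.
by rewrite -surjective_pairing.
Qed.

Lemma accessible_chart_takX m : takX a1 a2 m.2 (accessible_chart m).
Proof.
split; first by eexists; eexists; exact: accessible_chartE.
move=> i /accessible_chart_eq [_]; rewrite -surjective_pairing => e.
by have := in_fibre_chart_normal m; rewrite e loc_notin_fibre.
Qed.

(** The local inverse first moves from the arbitrary chart [c] to that of the normal form by
    [normal_local], then applies [inv_orig] or [unexc]. *)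
Lemma accessible_chart_local m c z : accessible_chart m = pt a1 a2 c z m.2 ->
  exists h : C * C * C -> C * C * C, holomorphic_near h (z, m.2) /\
    \forall w \near (z, m.2), accessible_chart (h w) = pt a1 a2 c w.1 w.2.
Proof.
move=> /accessible_chart_eq [_ e].
have := @normal_local C a1 a2 m.2 (c, z); rewrite -e /=.
rewrite /chart_normal; case: ifPn => /= m0 /(_ isT) [k [kh k1 k2]].
- pose f w : C * C * C := (k w, w.2).
  have fh : holomorphic_near f (z, m.2).
    by apply: holomorphic_near_pair => //; exact: holomorphic_near_snd.
  have f0 : (f (z, m.2)).1.1 != 0 by rewrite /f k1 orig_neq0.
  exists (fun w => (inv_orig D (f w), w.2)); split.
    apply: holomorphic_near_pair; last exact: holomorphic_near_snd.
    apply: holomorphic_near_comp => //.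
    by apply: filterS (near_x_neq0 f0) => w; exact: differentiable_inv_orig.
  have := differentiable_continuous (nbhs_singleton fh) (near_x_neq0 f0).
  apply: filterS2 k2 => w -> w0.
  by rewrite /accessible_chart /= inv_orig_neq0 // (inv_origK _ w0).
- pose f w : C * C * C := (k w, w.2).
  have fh : holomorphic_near f (z, m.2).
    by apply: holomorphic_near_pair => //; exact: holomorphic_near_snd.
  have f0 : unexc_dom D (f (z, m.2)) != 0 by rewrite /f k1 unexc_dom0.
  have fn := differentiable_near_neq0 (differentiable_unexc_dom D _) f0.
  exists (fun w => (unexc D (f w), w.2)); split.
    apply: holomorphic_near_pair; last exact: holomorphic_near_snd.
    apply: holomorphic_near_comp => //.
    by apply: filterS fn => w; exact: differentiable_unexc.
  have := differentiable_continuous (nbhs_singleton fh) fn.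
  by apply: filterS2 k2 => w -> /unexcK.
Qed.

Lemma accessible_chart_open t :
  takX_open a1 a2 t [set w | exists2 m, m.2 = t & w = accessible_chart m].
Proof.
split=> [_ [m <- ->]|c]; first exact: accessible_chart_takX.
rewrite openE => z [m <-] /esym /accessible_chart_local [h [_ hw]].
have hc : {for z, continuous (fun z' : C * C => (z', m.2))}.
  by apply: differentiable_continuous; differentiate.
have {hc}hw : nbhs z [set z' : C * C | accessible_chart (h (z', m.2)) =
    pt a1 a2 c z' m.2] by exact: hc hw.
move: hw; rewrite /interior /=; apply: filterS => z' /=.
move=> hz; exists (h (z', m.2)); last exact/esym.
by have /accessible_chart_eq [] := hz.
Qed.

(** A proper transform is a closure, so it is avoided by exhibiting an open neighbourhood disjoint
    from [S]: the image of the chart, all of whose normal forms lie in the fibre. *)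
Lemma accessible_chart_transform m (S : set (tak_point C)) :
  (forall w, S w -> exists c z, w = pt a1 a2 c z m.2 /\
     in_fibre (normal_form a1 a2 m.2 (c, z)) = false) ->
  ~ proper_transform a1 a2 m.2 S (accessible_chart m).
Proof.
move=> Sn [_ /(_ _ (accessible_chart_open m.2))] []; first by exists m.
move=> w [[m' _ wE] [/Sn [c [z [wE' +]]] _]].
move: wE'; rewrite wE => /accessible_chart_eq [_ <-].
by rewrite in_fibre_chart_normal.
Qed.

Lemma accessible_chart_takE m : takE a1 a2 m.2 (accessible_chart m).
Proof.
split; first exact: accessible_chart_takX.
case=> [||| [i Ni]]; apply: accessible_chart_transform => _ [x [->|->]].
all: eexists; eexists; split; first reflexivity.
all: rewrite /normal_form /=; do ?case: ifP => //=.
all: rewrite /in_fibre /= ?eqxx ?(negPf Ni) //.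
Qed.

Lemma accessible_chartP : bundle_chart a1 a2 accessible_chart.
Proof.
split.
- exact: accessible_chart_inj.
- exact: accessible_chart_takE.
- move=> m; have [m0|m0] := eqVneq m.1.1 0.
    have d0 : exc_dom D m != 0.
      by case: m m0 => -[x y] t /= ->; exact: exc_dom0.
    exists (uv (exc_center D)), (exc D); split.
      exact: holomorphic_near_neq0 (differentiable_exc_dom D) (@differentiable_exc _ _ _ D) d0.
    apply: filterS (differentiable_near_neq0 (differentiable_exc_dom D m) d0).
    exact: accessible_chart_exc.
  exists qp, (orig D); split.
    by apply: filterS (near_x_neq0 m0); exact: differentiable_orig.
  by apply: filterS (near_x_neq0 m0) => m' m'0; rewrite /accessible_chart m'0.
- exact: accessible_chart_local.
Qed.

(** Normal forms in [qp] are unique, so the original variables exist only off [x = 0] and agree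
    there with [orig]. Derivatives of [g] can therefore be computed from [orig]. *)
Lemma original_vars_near (m : C * C * C) g : original_vars a1 a2 accessible_chart g m ->
  m.1.1 != 0 /\ \forall m' \near m, g m' = orig D m'.
Proof.
move=> [_ gm]; have gE m' : accessible_chart m' = pt a1 a2 qp (g m') m'.2 ->
    m'.1.1 != 0 /\ g m' = orig D m'.
  move=> /accessible_chart_eq [_]; rewrite /chart_normal /normal_form /=.
  by case: ifPn; case: (g m') => q p // _ [<-].
split; first by have [] := gE _ (nbhs_singleton gm).
by apply: filterS gm => m' /gE [].
Qed.

End AccessibleChart.

(** * The four charts *)

(** Any other normal form lies in D. In all but one case the point is on one of the defining curves
    itself; the point [U = 0] of an accessible curve is reached only by taking the closure. *)
Lemma takE_in_fibre (C : numClosedFieldType) (a1 a2 t : C) w :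
  takE a1 a2 t w ->
  (exists q p, w = pt a1 a2 qp (q, p) t /\ q != 0) \/
  (exists i u, w = pt a1 a2 (uv i) (u, 0) t /\ accessible i).
Proof.
case=> Xw; have [[c [z]]] := Xw; rewrite pt_normal => wE _ notD.
have Dw S : S w -> proper_transform a1 a2 t S w.
  by move=> Sw; split=> // O _ Ow; exists w.
move: wE; case: (normal_form a1 a2 t (c, z)) / (normal_formP a1 a2 t (c, z)) => /= [q p|q|p||i u|i] wE.
- left; exists q, p; split=> //; apply/eqP => q0; apply: notD.
  by apply: Or41; apply: Dw; exists p; left; rewrite wE q0.
- by case: notD; apply: Or43; apply: Dw; exists q; left.
- by case: notD; apply: Or42; apply: Dw; exists p; left.
- by case: notD; apply: Or42; apply: Dw; exists 0; right.
- right; exists i, u; split=> //; apply/negPn/negP => Ni; apply: notD.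
  by apply: Or44; exists i => //; apply: Dw; exists u; left.
- case: notD; apply: Or44.
  have [Ai|Ni] := boolP (accessible i); last first.
    by exists i => //; apply: Dw; exists 0; right.
  have [j [Nj ij]] : exists j, ~~ accessible j /\ loc a1 a2 t i = (uv j, (0, 0)).
    by case: (i) Ai => // _; [exists q2|exists q4|exists q13|exists q19].
  (* The points [V = v] of the chart [UV i] with [U = 0] and [v <> 0] lie on
     the exceptional curve of [j]. *)
  exists j => //; split=> // O [OX Oo] Ow.
  have O0 : nbhs ((0, 0) : C * C) [set z' | O (pt a1 a2 (UV i) z' t)].
    by apply: open_nbhs_nbhs; split; [exact: Oo|rewrite /= -wE].
  have ic : {for 0, continuous (fun V : C => (0 : C, V))}.
    by apply: differentiable_continuous; differentiate.
  have /nbhs_ballP[e e0 eO] : nbhs (0 : C) [set V | O (pt a1 a2 (UV i) (0, V) t)].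
    exact: ic O0.
  have e2 : e / 2 != 0 by rewrite mulf_neq0 ?invr_eq0 ?pnatr_eq0 ?gt_eqF.
  have Ov : O (pt a1 a2 (UV i) (0, e / 2) t).
    apply: eO; rewrite /ball /= sub0r normrN gtr0_norm ?divr_gt0 //.
    by rewrite ltr_pdivrMr // ltr_pMr // ltr1n.
  exists (pt a1 a2 (UV i) (0, e / 2) t); split=> //; split; last exact: OX.
  exists (e / 2); left; apply: glue_pt.
  by have := glue_UV a1 a2 t i 0 e2; rewrite down_UVE ij /= !mul0r !add0r.
Qed.

Lemma chart_covers (C : numClosedFieldType) (a1 a2 t : C)
  (D : chart_data a1 a2) w :
  (exists q p, w = pt a1 a2 qp (q, p) t /\ q != 0) \/
  (exists u, w = pt a1 a2 (uv (exc_center D)) (u, 0) t) ->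
  exists m, w = accessible_chart D m.
Proof.
case=> [[q [p [-> q0]]]|[u ->]].
  exists (inv_orig D (q, p, t), t); rewrite /accessible_chart /= inv_orig_neq0 //.
  by rewrite (inv_origK D (m := (q, p, t))).
exists (unexc D (u, 0, t), t); rewrite (unexcK (w := (u, 0, t))) //=.
exact: unexc_dom0.
Qed.

Section ZeroChart.
Variables (C : numClosedFieldType) (b : C).

(* The chart [q = x], [p = b / x + y x] covers the exceptional curve of [q_3] for
   [b = 4 a_1] and that of [q_5] for [b = - 4 a_1]. *)
Definition zero_orig (m : C * C * C) : C * C := (m.1.1, b / m.1.1 + m.1.2 * m.1.1).

Definition zero_inv_orig (m : C * C * C) : C * C :=
  (m.1.1, (m.1.1 * m.1.2 - b) / m.1.1 ^+ 2).

(** This and [zero_undom] are both the product [q p], in the coordinates [(x,y)] and [(u,v)]. The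
    formulas of [zero_exc] follow from [v = 1 / p] and [y x ^ 2 = u v ^ 2]. *)
Definition zero_dom (m : C * C * C) : C := b + m.1.2 * m.1.1 ^+ 2.

Definition zero_exc (m : C * C * C) : C * C :=
  (m.1.2 * zero_dom m ^+ 2, m.1.1 / zero_dom m).

Definition zero_undom (w : C * C * C) : C := b + w.1.1 * w.1.2 ^+ 2.

Definition zero_unexc (w : C * C * C) : C * C :=
  (w.1.2 * zero_undom w, w.1.1 / zero_undom w ^+ 2).

End ZeroChart.

(** On the exceptional curve [q p] equals [b], so [b <> 0] keeps both changes of coordinates regular
    there. *)
Lemma zero_chart_exists (C : numClosedFieldType) (a1 a2 b : C) (i j : center)
    (b0 : b != 0) (Ai : accessible i) (Nj : ~~ accessible j)
    (iE : forall t, loc a1 a2 t i = (uv j, (0, 0)))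
    (glue_i : forall t u v : C, v != 0 ->
      glue a1 a2 t (uv i, (u, v)) (qP, (zero_undom b (u, v, t) * v, v))) :
  exists D : chart_data a1 a2, exc_center D = i /\ orig D = zero_orig b.
Proof.
unshelve refine (ex_intro _ (@ChartData C a1 a2 i j (zero_orig b)
  (zero_inv_orig b) (zero_exc b) (zero_unexc b) (zero_dom b) (zero_undom b) Ai Nj iE
  _ _ _ _ _ _ _ _ _ _ _ _ _ _ _ _ _ _ _)
  (conj erefl erefl)).
- by move=> m m0; rewrite /zero_orig; differentiate.
- by move=> m m0; rewrite /zero_inv_orig; differentiate; rewrite ?expf_neq0.
- by move=> m m0; rewrite /zero_exc /zero_dom; differentiate.
- by move=> m m0; rewrite /zero_unexc /zero_undom; differentiate; rewrite expf_neq0.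
- by move=> m; rewrite /zero_dom; differentiate.
- by move=> m; rewrite /zero_undom; differentiate.
- by [].
- by [].
- move=> [[q p] t] /= q0; rewrite /zero_orig /zero_inv_orig /=; congr pair; field.
  exact: q0.
- move=> [[x y] t] /= x0; rewrite /zero_orig /zero_inv_orig /=; congr pair; field.
  exact: x0.
- by move=> y t; rewrite /zero_dom /= expr0n mulr0 addr0.
- by move=> u t; rewrite /zero_undom /= expr0n mulr0 addr0.
- by move=> y t; rewrite /zero_exc /= mul0r.
- by move=> u t; rewrite /zero_unexc /= mul0r.
- move=> [[x y] t]; rewrite /zero_dom /zero_undom /zero_exc /zero_dom /= => d0.
  by rewrite [X in X != 0](_ : _ = b + y * x ^+ 2) //; field.
- move=> [[x y] t]; rewrite /zero_unexc /zero_undom /zero_exc /zero_dom /= => d0.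
  by congr pair; field; rewrite ?v0 ?d0.
- move=> u t; rewrite /zero_exc /zero_dom /zero_unexc /zero_undom /=.
  by congr pair; field; rewrite b0.
- by move=> [[u v] t] /= v0 d0; rewrite /zero_unexc mulf_neq0.
- move=> [[u v] t] /= v0 d0; apply: glue_trans (glue_i _ _ _ v0) _.
  apply: glue_sym; rewrite /zero_orig /zero_unexc /=.
  have -> : b / (v * zero_undom b (u, v, t)) + u / zero_undom b (u, v, t) ^+ 2 *
      (v * zero_undom b (u, v, t)) = v^-1.
    by move: d0; rewrite /zero_undom /= => d0; field; rewrite v0.
  rewrite mulrC; have := @glue_qp_qP C a1 a2 t (zero_undom b (u, v, t) * v) v^-1.
  by rewrite invrK invr_eq0; exact.
Qed.

Section InfinityChart.
Variables (C : numClosedFieldType) (s c : C).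

(* The chart [q = 1 / x], [p = s (q ^ 3 / 8 + t q) + c x + y x ^ 3] covers the
   exceptional curve of [q_14] for [s = 1] and that of [q_20] for [s = - 1].
   There [q ^ 3 / p] is [infinity_undom] in the coordinates [(u,v)] and the
   inverse of [infinity_dom] in the coordinates [(x,y)]; the formulas for [y] and
   [u] result from dividing by [x ^ 6] the equation that their product is 1. *)
Definition infinity_orig (m : C * C * C) : C * C := (m.1.1^-1,
  s * (1 / (8 * m.1.1 ^+ 3) + m.2 / m.1.1) + c * m.1.1 + m.1.2 * m.1.1 ^+ 3).

Definition infinity_inv_orig (m : C * C * C) : C * C := (m.1.1^-1,
  (m.1.2 - s * (m.1.1 ^+ 3 / 8 + m.2 * m.1.1) - c / m.1.1) * m.1.1 ^+ 3).

Definition infinity_dom (m : C * C * C) : C :=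
  s / 8 + s * m.2 * m.1.1 ^+ 2 + c * m.1.1 ^+ 4 + m.1.2 * m.1.1 ^+ 6.

Definition infinity_exc (m : C * C * C) : C * C :=
  (- (512 * m.2 ^+ 3 - 128 * s * m.2 * c + 8 * s * m.1.2 +
      ((512 * s * m.2 ^+ 2 - 64 * c) * c - 64 * s * m.2 * m.1.2) * m.1.1 ^+ 2 +
      (512 * s * m.2 ^+ 2 - 64 * c) * m.1.2 * m.1.1 ^+ 4) / infinity_dom m,
   m.1.1).

Definition infinity_undom (w : C * C * C) : C := 8 * s - 64 * s * w.2 * w.1.2 ^+ 2 +
  (512 * s * w.2 ^+ 2 - 64 * c) * w.1.2 ^+ 4 + w.1.1 * w.1.2 ^+ 6.

Definition infinity_unexc (w : C * C * C) : C * C := (w.1.2,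
  - (512 * w.2 ^+ 3 - 128 * s * w.2 * c + s * w.1.1 / 8 +
     ((512 * s * w.2 ^+ 2 - 64 * c) * c + s * w.2 * w.1.1) * w.1.2 ^+ 2 +
     c * w.1.1 * w.1.2 ^+ 4) / infinity_undom w).

End InfinityChart.

(* The conditions left by [field] are 8 times the denominators, as it clears the
   numerical denominators first. *)
Ltac dom_neq0 n8 d0 :=
  move: (mulf_neq0 n8 d0); congr (is_true (_ != 0)); field.

(** In the product of [infinity_dom] and [infinity_undom] the constant term is [s ^ 2 = 1] and the
    terms in [x ^ 2] and [x ^ 4] cancel, which permits the division by [x ^ 6]. The identities are
    checked separately for the two values of [s]. *)
Lemma infinity_chart_exists (C : numClosedFieldType) (a1 a2 s c : C)
    (i j : center) (s1 : s = 1 \/ s = -1)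
    (Ai : accessible i) (Nj : ~~ accessible j)
    (iE : forall t, loc a1 a2 t i = (uv j, (0, 0)))
    (glue_i : forall t u v : C, v != 0 -> glue a1 a2 t
      (uv i, (u, v)) (QP, (v, infinity_undom s c (u, v, t) * v ^+ 3))) :
  exists D : chart_data a1 a2, exc_center D = i /\ orig D = infinity_orig s c.
Proof.
have s0 : s != 0 by case: s1 => ->; rewrite ?oppr_eq0 oner_eq0.
have n8 : 8 != 0 :> C by rewrite pnatr_eq0.
unshelve refine (ex_intro _ (@ChartData C a1 a2 i j
  (infinity_orig s c) (infinity_inv_orig s c) (infinity_exc s c) (infinity_unexc s c) (infinity_dom s c)
  (infinity_undom s c) Ai Nj iE
  _ _ _ _ _ _ _ _ _ _ _ _ _ _ _ _ _ _ _)
  (conj erefl erefl)).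
- move=> m m0; rewrite /infinity_orig; differentiate => //.
  by rewrite mulf_neq0 ?expf_neq0.
- by move=> m m0; rewrite /infinity_inv_orig; differentiate.
- by move=> m m0; rewrite /infinity_exc; move: m0; rewrite /infinity_dom => m0; differentiate.
- by move=> m m0; rewrite /infinity_unexc; move: m0; rewrite /infinity_undom => m0; differentiate.
- by move=> m; rewrite /infinity_dom; differentiate.
- by move=> m; rewrite /infinity_undom; differentiate.
- by move=> m m0; rewrite invr_eq0.
- by move=> m m0; rewrite invr_eq0.
- move=> [[q p] t] /= q0; rewrite /infinity_orig /infinity_inv_orig /= invrK; congr pair; field.
  by rewrite q0.
- move=> [[x y] t] /= x0; rewrite /infinity_orig /infinity_inv_orig /= invrK; congr pair; field.
  by rewrite x0.
- move=> y t; rewrite /infinity_dom /= !expr0n /= !mulr0 !addr0.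
  by rewrite mulf_neq0 ?invr_eq0.
- by move=> u t; rewrite /infinity_undom /= !expr0n /= !mulr0 !addr0 subr0 mulf_neq0.
- by move=> y t; rewrite /infinity_exc.
- by move=> u t; rewrite /infinity_unexc.
- move=> [[x y] t] d0; rewrite [X in X != 0](_ : _ = (infinity_dom s c (x, y, t))^-1).
    by rewrite invr_eq0.
  move: d0; rewrite /infinity_undom /infinity_exc /infinity_dom /= => d0.
  by case: s1 d0 => -> d0; field; dom_neq0 n8 d0.
- move=> [[x y] t] d0.
  have uE : infinity_undom s c (infinity_exc s c (x, y, t), t) = (infinity_dom s c (x, y, t))^-1.
    move: d0; rewrite /infinity_undom /infinity_exc /infinity_dom /= => d0.
    by case: s1 d0 => -> d0; field; dom_neq0 n8 d0.
  rewrite /infinity_unexc uE invrK; move: d0; rewrite /infinity_exc /infinity_dom /= => d0.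
  by congr pair; case: s1 d0 => -> d0; field; dom_neq0 n8 d0.
- move=> u t; rewrite /infinity_exc /infinity_dom /infinity_unexc /infinity_undom /=.
  rewrite !expr0n /= !mulr0 !addr0 subr0.
  by congr pair; case: s1 => ->; field.
- by move=> [[u v] t] /= v0 _; rewrite /infinity_unexc.
- move=> [[u v] t] /= v0 d0; apply: glue_trans (glue_i _ _ _ v0) _.
  have -> : infinity_orig s c (infinity_unexc s c (u, v, t), t) = (v^-1, (infinity_undom s c (u, v, t) * v ^+ 3)^-1).
    move: d0; rewrite /infinity_orig /infinity_unexc /infinity_undom /= => d0.
    by congr pair; case: s1 d0 => -> d0; field;
      rewrite v0 /=; move: d0; congr (is_true (_ != 0)); ring.
  set P := _ * _; have P0 : P != 0 by rewrite mulf_neq0 // expf_neq0.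
  apply: (@glue_trans _ _ _ _ _ (qP, (v^-1, P))).
    have := @glue_qP_QP C a1 a2 t v^-1 P; rewrite invrK invr_eq0.
    by move=> /(_ v0); exact: glue_sym.
  have := @glue_qp_qP C a1 a2 t v^-1 P^-1; rewrite invrK invr_eq0.
  by move=> /(_ P0); exact: glue_sym.
Qed.

(** * The Hamiltonian systems *)

Lemma eq_scale (C : fieldType) (k A B L R : C) :
  k != 0 -> A - B = k * (L - R) -> L = R <-> A = B.
Proof.
move=> k0 e; split=> [LR|AB]; apply/eqP; rewrite -subr_eq0.
  by rewrite e LR subrr mulr0.
by move/eqP: e; rewrite AB subrr eq_sym mulf_eq0 (negPf k0).
Qed.

(** The first Hamilton equation determines x', and the second equations are compared only after
    substituting it. *)
Lemma and_iff2l (A B1 B2 A' : Prop) :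
  (A <-> A') -> (A' -> (B1 <-> B2)) -> (A /\ B1 <-> A' /\ B2).
Proof. tauto. Qed.

Section ChartEquations.
Variables (C : numClosedFieldType) (a1 a2 : C) (D : chart_data a1 a2).

Lemma chart_extends_dq_dp (F : C * C -> C) :
  (forall z, differentiable F z) ->
  (forall m : C * C * C, m.1.1 != 0 ->
    F m.1 = ('D_(ex C) (orig D) m).1 * ('D_(ey C) (orig D) m).2 -
            ('D_(ey C) (orig D) m).1 * ('D_(ex C) (orig D) m).2) ->
  extends_dq_dp a1 a2 (accessible_chart D) F.
Proof.
move=> Fd FE; split=> // m g /original_vars_near [m0 gE].
by rewrite !(near_eq_derive _ gE) FE.
Qed.

Lemma chart_hamiltonian (alpha beta : C) (F : C * C -> C) (H : C * C * C -> C) :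
  (forall (m : C * C * C) (x' y' : C), m.1.1 != 0 ->
    'D_((x', y'), 1) (orig D) m = takasaki alpha beta m.2 (orig D m) <->
    F m.1 * x' = 'D_(ey C) H m /\ F m.1 * y' = - 'D_(ex C) H m) ->
  hamiltonian_in_chart a1 a2 alpha beta (accessible_chart D) F H.
Proof.
move=> HE m g /original_vars_near [m0 gE] x' y'.
by rewrite (near_eq_derive _ gE) (nbhs_singleton gE); exact: HE.
Qed.

End ChartEquations.

Definition coef3 (C : numClosedFieldType) (k : C) : {poly {poly {poly C}}} :=
  k%:P%:P%:P.

(** The nesting follows [eval3]: the outermost indeterminate is t, the innermost x. *)
Definition var_x (C : numClosedFieldType) : {poly {poly {poly C}}} := 'X%:P%:P.
Definition var_y (C : numClosedFieldType) : {poly {poly {poly C}}} := 'X%:P.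
Definition var_t (C : numClosedFieldType) : {poly {poly {poly C}}} := 'X.

Lemma eval3D (C : numClosedFieldType) (h k : {poly {poly {poly C}}}) m :
  eval3 (h + k) m = eval3 h m + eval3 k m.
Proof. by rewrite /eval3 !hornerD. Qed.

Lemma eval3M (C : numClosedFieldType) (h k : {poly {poly {poly C}}}) m :
  eval3 (h * k) m = eval3 h m * eval3 k m.
Proof. by rewrite /eval3 !hornerM. Qed.

Lemma eval3X (C : numClosedFieldType) (h : {poly {poly {poly C}}}) n m :
  eval3 (h ^+ n) m = eval3 h m ^+ n.
Proof. by rewrite /eval3 !horner_exp. Qed.

Lemma eval3_coef (C : numClosedFieldType) (k : C) m : eval3 (coef3 k) m = k.
Proof. by rewrite /eval3 !hornerC. Qed.

Lemma eval3_x (C : numClosedFieldType) (m : C * C * C) :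
  eval3 (var_x C) m = m.1.1.
Proof. by rewrite /eval3 !hornerC hornerX. Qed.

Lemma eval3_y (C : numClosedFieldType) (m : C * C * C) :
  eval3 (var_y C) m = m.1.2.
Proof. by rewrite /eval3 hornerC hornerX hornerC. Qed.

Lemma eval3_t (C : numClosedFieldType) (m : C * C * C) :
  eval3 (var_t C) m = m.2.
Proof. by rewrite /eval3 hornerX !hornerC. Qed.

Definition eval3E :=
  (eval3D, eval3M, eval3X, eval3_coef, eval3_x, eval3_y, eval3_t).

(** This is [p^2/2 + 4 beta/q^2 - (t^2 - alpha) q^2/2 - t q^4/8 - q^6/128] rewritten in the chart.
    The poles [b^2/(2 x^2)] and [4 beta/x^2] cancel when [8 beta = - b^2]. *)
Definition zero_hamiltonian (C : numClosedFieldType) (b alpha : C) :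
    {poly {poly {poly C}}} :=
  coef3 b * var_y C + coef3 (1 / 2) * var_x C ^+ 2 * var_y C ^+ 2
  + (coef3 (alpha / 2) + coef3 (- 1 / 2) * var_t C ^+ 2) * var_x C ^+ 2
  + coef3 (- 1 / 8) * var_t C * var_x C ^+ 4 + coef3 (- 1 / 128) * var_x C ^+ 6.

Lemma zero_chart_hamiltonian (C : numClosedFieldType) (a1 a2 b alpha beta : C)
    (D : chart_data a1 a2) :
  orig D = zero_orig b ->
  8 * beta = - b ^+ 2 ->
  hamiltonian_in_chart a1 a2 alpha beta (accessible_chart D) fst
    (eval3 (zero_hamiltonian b alpha)).
Proof.
move=> DE bE; apply: chart_hamiltonian => m x' y' m0.
have -> : eval3 (zero_hamiltonian b alpha) = (fun m : C * C * C =>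
    b * m.1.2 + 1 / 2 * m.1.1 ^+ 2 * m.1.2 ^+ 2
    + (alpha / 2 + - 1 / 2 * m.2 ^+ 2) * m.1.1 ^+ 2
    + - 1 / 8 * m.2 * m.1.1 ^+ 4 + - 1 / 128 * m.1.1 ^+ 6).
  by apply/funext => m'; rewrite /zero_hamiltonian !eval3E.
rewrite DE /zero_orig.
rewrite /takasaki bE /ex /ey.
erewrite !has_diff_derive; try by repeat diff_rule.
case: m m0 => -[x y] t /= x0.
rewrite pair_equal_spec; apply: and_iff2l => [|x'E].
  by apply: (@eq_scale _ x) => //; field.
have -> : x' = b / x + y * x by apply: (mulfI x0); rewrite x'E; field.
by apply: (@eq_scale _ 1); rewrite ?oner_eq0 //; field.
Qed.

Lemma zero_chart_extends_dq_dp (C : numClosedFieldType) (a1 a2 b : C)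
    (D : chart_data a1 a2) :
  orig D = zero_orig b ->
  extends_dq_dp a1 a2 (accessible_chart D) fst.
Proof.
move=> DE; apply: chart_extends_dq_dp => [z|m m0]; first by differentiate.
rewrite DE /zero_orig.
rewrite /ex /ey; erewrite !has_diff_derive; try by repeat diff_rule.
by case: m m0 => -[x y] t /= x0; ring.
Qed.

(** Here the change of variables depends on t, so [s q^2/2] is added to the original Hamiltonian;
    the term [s t c], a function of t alone, is dropped. The remaining pole in [q^2] cancels exactly
    for [c = - 4 (1 + s alpha)]. *)
Definition infinity_hamiltonian (C : numClosedFieldType) (s c beta : C) :
    {poly {poly {poly C}}} :=
  (coef3 (s / 8) + coef3 s * var_t C * var_x C ^+ 2 + coef3 c * var_x C ^+ 4)
    * var_y C
  + coef3 (1 / 2) * var_x C ^+ 6 * var_y C ^+ 2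
  + coef3 (c ^+ 2 / 2 + 4 * beta) * var_x C ^+ 2.

Lemma infinity_chart_hamiltonian (C : numClosedFieldType)
    (a1 a2 s c alpha beta : C) (D : chart_data a1 a2) :
  s = 1 \/ s = -1 -> orig D = infinity_orig s c ->
  c = - 4 * (1 + s * alpha) ->
  hamiltonian_in_chart a1 a2 alpha beta (accessible_chart D) (fun z => - z.1)
    (eval3 (infinity_hamiltonian s c beta)).
Proof.
move=> s1 DE cE; apply: chart_hamiltonian => m x' y' m0.
have -> : eval3 (infinity_hamiltonian s c beta) = (fun m : C * C * C =>
    (s / 8 + s * m.2 * m.1.1 ^+ 2 + c * m.1.1 ^+ 4) * m.1.2
    + 1 / 2 * m.1.1 ^+ 6 * m.1.2 ^+ 2
    + (c ^+ 2 / 2 + 4 * beta) * m.1.1 ^+ 2).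
  by apply/funext => m'; rewrite /infinity_hamiltonian !eval3E.
rewrite DE /infinity_orig.
have x3 : 8 * m.1.1 ^+ 3 != 0 by apply: mulf_neq0; [rewrite pnatr_eq0|exact: expf_neq0].
rewrite /takasaki /ex /ey.
erewrite !has_diff_derive; try by repeat diff_rule.
case: m m0 {x3} => -[x y] t /= x0; rewrite cE.
rewrite pair_equal_spec; apply: and_iff2l => [|x'E].
  (* The factor is the quotient of the coefficients of x', which are [- x] in the Hamilton equation
     and [- x ^- 2] in dq/dt. *)
  by apply: (@eq_scale _ (x ^+ 3)); rewrite ?expf_neq0 //; case: s1 => ->; field.
have -> : x' = - x ^+ 2 * (s * (1 / (8 * x ^+ 3) + t / x) +
    (- 4 * (1 + s * alpha)) * x + y * x ^+ 3).
  by apply: (mulfI x0); apply: oppr_inj; rewrite -mulNr x'E; field.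
(* Likewise for y', with coefficients [- x] and [x ^ 3]. *)
apply: (@eq_scale _ (- x ^- 2)); first by rewrite oppr_eq0 invr_eq0 expf_neq0.
by case: s1 => ->; field.
Qed.

Lemma infinity_chart_extends_dq_dp (C : numClosedFieldType) (a1 a2 s c : C)
    (D : chart_data a1 a2) :
  orig D = infinity_orig s c ->
  extends_dq_dp a1 a2 (accessible_chart D) (fun z => - z.1).
Proof.
move=> DE; apply: chart_extends_dq_dp => [z|m m0]; first by differentiate.
rewrite DE /infinity_orig.
have x3 : 8 * m.1.1 ^+ 3 != 0 by apply: mulf_neq0; [rewrite pnatr_eq0|exact: expf_neq0].
rewrite /ex /ey; erewrite !has_diff_derive; try by repeat diff_rule.
by case: m m0 {x3} => -[x y] t /= x0; field.
Qed.

(** * Chains of blow-downs and assembly of the atlas *)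

Lemma glue_blow_down (C : numClosedFieldType) (a1 a2 t : C) i u v w :
  v != 0 -> glue a1 a2 t (down_uv a1 a2 t i u v) w ->
  glue a1 a2 t (uv i, (u, v)) w.
Proof. by move=> v0; apply: glue_trans; exact: glue_uv. Qed.

Lemma glue_eq (C : numClosedFieldType) (a1 a2 t : C) w w' :
  w = w' -> glue a1 a2 t w w'.
Proof. by move=> ->; exact: glue_refl. Qed.

(** Each blow-down in the chain keeps [v] and replaces [u] by the position of the centre plus [u v],
    as in a Horner scheme. *)
Lemma glue_q3 (C : numClosedFieldType) (a1 a2 t u v : C) : v != 0 ->
  glue a1 a2 t (uv q3, (u, v)) (qP, (zero_undom (4 * a1) (u, v, t) * v, v)).
Proof.
move=> v0; do 3![apply: glue_blow_down => //; rewrite /down_uv /= ?add0r].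
by apply: glue_eq; congr (_, (_, _)); rewrite /zero_undom /=; ring.
Qed.

Lemma glue_q5 (C : numClosedFieldType) (a1 a2 t u v : C) : v != 0 ->
  glue a1 a2 t (uv q5, (u, v)) (qP, (zero_undom (- (4 * a1)) (u, v, t) * v, v)).
Proof.
move=> v0; do 3![apply: glue_blow_down => //; rewrite /down_uv /= ?add0r].
by apply: glue_eq; congr (_, (_, _)); rewrite /zero_undom /=; ring.
Qed.

Lemma glue_q8 (C : numClosedFieldType) (a1 a2 t u v : C) : v != 0 ->
  glue a1 a2 t (uv q8, (u, v)) (QP, (v, u * v ^+ 3)).
Proof.
move=> v0; do 2![apply: glue_blow_down => //; rewrite /down_uv /= ?add0r].
(* The centre q_7 is given in the chart [UV q6], so this blow-down has the other form. *)
apply: glue_trans (@glue_UV _ _ _ _ _ _ _ v0) _; rewrite /down_UV /= !add0r.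
by apply: glue_eq; congr (_, (_, _)); ring.
Qed.

(** Six blow-downs lead to the common stem at q_8. The position of q_13 is the coefficient of
    [v ^ 4], namely [512 s t^2 - 64 c], which fixes [c]. *)
Lemma glue_q14 (C : numClosedFieldType) (a1 a2 t u v : C) : v != 0 ->
  glue a1 a2 t (uv q14, (u, v)) (QP,
    (v, infinity_undom 1 (- 4 * (2 - a1 - 2 * a2)) (u, v, t) * v ^+ 3)).
Proof.
move=> v0; do 6![apply: glue_blow_down => //; rewrite /down_uv /= ?add0r].
apply: glue_trans (glue_q8 _ _ _ _ v0) _.
by apply: glue_eq; congr (_, (_, _)); rewrite /infinity_undom /=; ring.
Qed.

Lemma glue_q20 (C : numClosedFieldType) (a1 a2 t u v : C) : v != 0 ->
  glue a1 a2 t (uv q20, (u, v)) (QP,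
    (v, infinity_undom (-1) (- 4 * (a1 + 2 * a2)) (u, v, t) * v ^+ 3)).
Proof.
move=> v0; do 6![apply: glue_blow_down => //; rewrite /down_uv /= ?add0r].
apply: glue_trans (glue_q8 _ _ _ _ v0) _.
by apply: glue_eq; congr (_, (_, _)); rewrite /infinity_undom /=; ring.
Qed.

(** The data form a single triple so that one application of [choice] yields the whole atlas. *)
Definition has_hamiltonian_chart (C : numClosedFieldType) (a1 a2 : C)
    (i : center) : Prop :=
  exists x : chart_data a1 a2 * (C * C -> C) * {poly {poly {poly C}}},
    [/\ exc_center x.1.1 = i,
        extends_dq_dp a1 a2 (accessible_chart x.1.1) x.1.2 &
        hamiltonian_in_chart a1 a2 (1 - a1 - 2 * a2) (- 2 * a1 ^+ 2)
          (accessible_chart x.1.1) x.1.2 (eval3 x.2)].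

Lemma zero_has_hamiltonian_chart (C : numClosedFieldType) (a1 a2 b : C) i :
  (exists D : chart_data a1 a2, exc_center D = i /\ orig D = zero_orig b) ->
  8 * (- 2 * a1 ^+ 2) = - b ^+ 2 -> has_hamiltonian_chart a1 a2 i.
Proof.
move=> [D [Di DE]] bE.
exists (D, fst, zero_hamiltonian b (1 - a1 - 2 * a2)); split=> //=.
  exact: zero_chart_extends_dq_dp DE.
exact: zero_chart_hamiltonian DE bE.
Qed.

Lemma infinity_has_hamiltonian_chart (C : numClosedFieldType)
    (a1 a2 s c : C) i :
  (exists D : chart_data a1 a2, exc_center D = i /\ orig D = infinity_orig s c) ->
  s = 1 \/ s = -1 -> c = - 4 * (1 + s * (1 - a1 - 2 * a2)) ->
  has_hamiltonian_chart a1 a2 i.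
Proof.
move=> [D [Di DE]] s1 cE.
exists (D, fun z => - z.1, infinity_hamiltonian s c (- 2 * a1 ^+ 2)).
split=> //=; first exact: infinity_chart_extends_dq_dp DE.
exact: infinity_chart_hamiltonian s1 DE cE.
Qed.

(** The positions of the centres give exactly the constants that make the Hamiltonians polynomial:
    [b^2 = 16 a_1^2 = - 8 beta] at the zeros of q, and [c = - 4 (1 + s alpha)] at infinity. *)
Lemma hamiltonian_chart_exists (C : numClosedFieldType) (a1 a2 : C) i :
  a1 != 0 -> accessible i -> has_hamiltonian_chart a1 a2 i.
Proof.
move=> a10; have b0 : 4 * a1 != 0 by rewrite mulf_neq0 ?pnatr_eq0.
case: i => // _.
- apply: (@zero_has_hamiltonian_chart _ _ _ (4 * a1)); last by ring.
  by apply: (@zero_chart_exists _ _ _ _ _ q2) => // *; exact: glue_q3.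
- apply: (@zero_has_hamiltonian_chart _ _ _ (- (4 * a1))); last by ring.
  apply: (@zero_chart_exists _ _ _ _ _ q4) => // *; last exact: glue_q5.
  by rewrite oppr_eq0.
- apply: (@infinity_has_hamiltonian_chart _ _ _ 1 (- 4 * (2 - a1 - 2 * a2)));
    [|by left|by ring].
  apply: (@infinity_chart_exists _ _ _ _ _ _ q13) => // *; last exact: glue_q14.
  by left.
- apply: (@infinity_has_hamiltonian_chart _ _ _ (-1) (- 4 * (a1 + 2 * a2)));
    [|by right|by ring].
  apply: (@infinity_chart_exists _ _ _ _ _ _ q19) => // *; last exact: glue_q20.
  by right.
Qed.

Theorem theorem4 (R : realType) (a1 a2 alpha beta : R[i])
    (a1_neq0 : a1 != 0)
    (alphaE : alpha = 1 - a1 - 2 * a2)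
    (betaE : beta = - 2 * a1 ^+ 2) :
  exists (n : nat) (phi : 'I_n -> R[i] * R[i] * R[i] -> tak_point R[i])
         (F : 'I_n -> R[i] * R[i] -> R[i])
         (H : 'I_n -> {poly {poly {poly R[i]}}}),
    [/\ forall i, bundle_chart a1 a2 (phi i),
        forall t w, takE a1 a2 t w -> exists i m, w = phi i m,
        forall i, extends_dq_dp a1 a2 (phi i) (F i) &
        forall i, hamiltonian_in_chart a1 a2 alpha beta (phi i) (F i)
                    (eval3 (H i))].
Proof.
pose cs := [tuple q3; q5; q14; q20].
have csP k : accessible (tnth cs k) by case: k => -[|[|[|[|]]]].
have [X XP] := choice (fun k => @hamiltonian_chart_exists _ a1 a2 _ a1_neq0 (csP k)).
exists 4, (fun k => accessible_chart (X k).1.1), (fun k => (X k).1.2), (fun k => (X k).2).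
rewrite alphaE betaE; split=> [k|t w|k|k].
- exact: accessible_chartP.
- move=> /takE_in_fibre [qpw|[i [u [wE Ai]]]].
    (* Every chart contains the points with [q <> 0], so the first one serves. *)
    by exists ord0; apply: (@chart_covers _ _ _ t); left.
  have [k kE] : exists k, tnth cs k = i.
    by case: i Ai {wE} => // _; [exists (inord 0)|exists (inord 1)|
      exists (inord 2)|exists (inord 3)]; rewrite (tnth_nth q3) inordK.
  exists k; apply: (@chart_covers _ _ _ t); right; exists u.
  by have [-> _ _] := XP k; rewrite kE.
- by have [] := XP k.
- by have [] := XP k.
Qed.
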